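(* Let $(\mathcal{A},\tau)$ be a non-commutative probability space with a tracial weight $\omega$, with domain $\operatorname{D}(\omega)\subset\mathcal{A}$. Consider $a,c,a_1,\ldots,a_k\in\operatorname{D}(\omega)$ and $b,b_1,\ldots,b_\ell\in\mathcal{A}$ such that $(a,a_1,\ldots,a_k)$ is trace class with respect to $\omega$ and the pair $(\{a,c,a_1,\ldots,a_k\},\{b,b_1,\ldots,b_\ell\})$ is cyclically monotone with respect to $(\omega,\tau)$. Then $((abc,a_1,\ldots,a_k),(b,b_1,\ldots,b_\ell))$ and $((\tau(b)ac,a_1,\ldots,a_k),(b,b_1,\ldots,b_\ell))$ have the same joint distribution with respect to $\omega$. In particular, the pair $(\{abc,a_1,\ldots,a_k\},\{b,b_1,\ldots,b_\ell\})$ is cyclically monotone with respect to $(\omega,\tau)$.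
   Context: A non-commutative probability space is a pair $(\mathcal{A},\tau)$ with $\mathcal{A}$ a unital $*$-algebra over $\mathbb{C}$ and $\tau:\mathcal{A}\to\mathbb{C}$ linear with $\tau(1_{\mathcal{A}})=1$; throughout $\tau$ is tracial: $\tau(xy)=\tau(yx)$. A tracial weight on $\mathcal{A}$ is a linear functional $\omega:\operatorname{D}(\omega)\to\mathbb{C}$ on a $*$-subalgebra $\operatorname{D}(\omega)\subset\mathcal{A}$ with $\omega(xy)=\omega(yx)$, $\omega(x^* )=\overline{\omega(x)}$ and $\omega(x^*x)\ge 0$ for all $x,y\in\operatorname{D}(\omega)$. A finite family $(a_1,\ldots,a_k)$ in $\operatorname{D}(\omega)$ is trace class with respect to $\omega$ if there are a separable Hilbert space $H$ and trace class operators $x_1,\ldots,x_k$ on $H$ with $\omega(a_{i_1}^{\epsilon_1}\cdots a_{i_m}^{\epsilon_m})=\operatorname{Tr}_H(x_{i_1}^{\epsilon_1}\cdots x_{i_m}^{\epsilon_m})$ for all $m\ge1$, all indices $i_j$ and all $\epsilon_j\in\{1,*\}$. Cyclic monotonicity: let $\mathcal{S},\mathcal{B}\subset\mathcal{A}$ be $*$-subalgebras with $1_{\mathcal{A}}\in\mathcal{B}$, and let $\operatorname{I}_{\mathcal{B}}(\mathcal{S})=\operatorname{span}\{b_0s_1b_1\cdots s_mb_m: m\ge1,\ s_i\in\mathcal{S},\ b_i\in\mathcal{B}\}$. The pair $(\mathcal{S},\mathcal{B})$ is cyclically monotone with respect to $(\omega,\tau)$ if $\operatorname{I}_{\mathcal{B}}(\mathcal{S})\subset\operatorname{D}(\omega)$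 and $\omega(s_1b_1\cdots s_mb_m)=\omega(s_1\cdots s_m)\tau(b_1)\cdots\tau(b_m)$ for all $m\ge1$, $s_i\in\mathcal{S}$, $b_i\in\mathcal{B}$. A pair of sets $(X,Y)$ with $X\subset\operatorname{D}(\omega)$, $Y\subset\mathcal{A}$ is cyclically monotone if $(\operatorname{alg}(X),\operatorname{alg}(\{1_{\mathcal{A}}\}\cup Y))$ is, where $\operatorname{alg}$ denotes the generated $*$-subalgebra (the unit is not adjoined to $\operatorname{alg}(X)$). Same joint distribution: let $u=(u_1,\ldots,u_r)$ and $u'=(u_1',\ldots,u_r')$ be tuples in $\operatorname{D}(\omega)$ and $v=(v_1,\ldots,v_s)$, $v'=(v_1',\ldots,v_s')$ tuples in $\mathcal{A}$, such that all elements $y_0x_1y_1\cdots x_ny_n$ with $n\ge1$, $x_i\in\operatorname{alg}(u)$, $y_i\in\operatorname{alg}(1_{\mathcal{A}},v)$ lie in $\operatorname{D}(\omega)$, and likewise for $(u',v')$. Then $(u,v)$ and $(u',v')$ have the same joint distribution if for every $n\ge1$, all non-commutative $*$-polynomials $p_1,\ldots,p_n$ in $r$ variables without constant term and all non-commutative $*$-polynomials $q_0,\ldots,q_n$ in $s$ variables, $$\omega\big(q_0(v)p_1(u)q_1(v)\cdots p_n(u)q_n(v)\big)=\omega\big(q_0(v')p_1(u')q_1(v')\cdots p_n(u')q_n(v')\big).$$ *)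

(* Defs.v *)
From HB Require Import structures.
From mathcomp Require Import all_boot all_order all_algebra.
From mathcomp Require Import complex.
From mathcomp Require Import all_classical all_reals all_analysis.
From mathcomp Require summability.
(* The notations of monalg clash with those of mathcomp-analysis. *)
From mathcomp Require Import (canonicals) monalg.

Set Implicit Arguments.
Unset Strict Implicit.
Unset Printing Implicit Defensive.

Import Order.TTheory GRing.Theory Num.Theory.
Import numFieldNormedType.Exports.

Local Open Scope classical_set_scope.
Local Open Scope ring_scope.

HB.mixin Record Algebra_isStarAlgebra (C : numClosedFieldType) A
    of GRing.Algebra C A := {
  star : A -> A;
  starK : involutive star;
  starD : {morph star : x y / x + y};
  starZ : forall (k : C) x, star (k *: x) = k^* *: star x;
  starM : forall x y, star (x * y) = star y * star x
}.

#[short(type="starAlgType")]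
HB.structure Definition StarAlgebra (C : numClosedFieldType) :=
  { A of Algebra_isStarAlgebra C A & GRing.Algebra C A }.

Section LinearSpan.
Context (K : nzRingType) (V : lmodType K).

Definition linear_subspace (S : set V) : Prop :=
  S 0 /\ forall (k : K) x y, S x -> S y -> S (k *: x + y).

Definition linear_span (X : set V) : set V := smallest linear_subspace X.

End LinearSpan.

Section NonCommutativeProbability.
Context (C : numClosedFieldType) (A : starAlgType C).

(* The unit of [A] is not required to belong to a star-subalgebra. *)
Definition star_subalgebra (S : set A) : Prop :=
  [/\ linear_subspace S,
      forall x y, S x -> S y -> S (x * y) &
      forall x, S x -> S (star x)].

Definition star_alg (X : set A) : set A := smallest star_subalgebra X.

Definition tracial_expectation (tau : {scalar A}) : Prop :=
  tau 1 = 1 /\ forall x y, tau (x * y) = tau (y * x).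

(* [weight_fun] is a total function, but only its values on [weight_dom] are
   meaningful. *)
Record tracial_weight := TracialWeight {
  weight_dom : set A;
  weight_fun :> A -> C;
  weight_dom_subalgebra : star_subalgebra weight_dom;
  weight_linear : forall (k : C) x y, weight_dom x -> weight_dom y ->
    weight_fun (k *: x + y) = k * weight_fun x + weight_fun y;
  weight_tracial : forall x y, weight_dom x -> weight_dom y ->
    weight_fun (x * y) = weight_fun (y * x);
  weight_star : forall x, weight_dom x -> weight_fun (star x) = (weight_fun x)^*;
  weight_ge0 : forall x, weight_dom x -> 0 <= weight_fun (star x * x)
}.

(* The letter [(i, false)] stands for the [i]-th variable and [(i, true)] for
   its adjoint. *)
Definition star_letter (r : nat) (u : r.-tuple A) (l : 'I_r * bool) : A :=
  if l.2 then star (tnth u l.1) else tnth u l.1.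

Definition star_word (r : nat) (u : r.-tuple A) (w : seq ('I_r * bool)) : A :=
  \prod_(l <- w) star_letter u l.

(* Non-commutative star-polynomials in [r] variables, as elements of the
   algebra of the free monoid on the variables and their adjoints. *)
Definition star_poly (r : nat) : Type :=
  monalg.malg (monalg.fmonom ('I_r * bool)%type) C.

Definition star_poly_eval (r : nat) (u : r.-tuple A) (p : star_poly r) : A :=
  monalg.mmap (in_alg A) (fun w => star_word u (monalg.fmonom_val w)) p.

Definition no_constant_term (r : nat) (p : star_poly r) : Prop :=
  monalg.mcoeff (monalg.FMonom [::]) p = 0.

(* The products [b_0 s_1 b_1 ... s_m b_m]. *)
Definition alternating_products (S B : set A) : set A :=
  [set z | exists (m : nat) (b0 : A) (s b : 'I_m -> A),
     [/\ (0 < m)%N, B b0, forall i, S (s i), forall i, B (b i) &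
         z = b0 * \prod_(i < m) (s i * b i)]].

Definition ideal_span (B S : set A) : set A :=
  linear_span (alternating_products S B).

Definition cyclically_monotone_alg (omega : tracial_weight) (tau : {scalar A})
    (S B : set A) : Prop :=
  [/\ star_subalgebra S, star_subalgebra B /\ B 1,
      ideal_span B S `<=` weight_dom omega &
      forall (m : nat) (s b : 'I_m -> A), (0 < m)%N ->
        (forall i, S (s i)) -> (forall i, B (b i)) ->
        omega (\prod_(i < m) (s i * b i)) =
          omega (\prod_(i < m) s i) * \prod_(i < m) tau (b i)].

Definition cyclically_monotone (omega : tracial_weight) (tau : {scalar A})
    (X Y : set A) : Prop :=
  X `<=` weight_dom omega /\
  cyclically_monotone_alg omega tau (star_alg X) (star_alg (1 |` Y)).

Definition jointly_in_domain (omega : tracial_weight) (r s : nat)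
    (u : r.-tuple A) (v : s.-tuple A) : Prop :=
  [set` u] `<=` weight_dom omega /\
  alternating_products (star_alg [set` u]) (star_alg (1 |` [set` v]))
    `<=` weight_dom omega.

Definition same_joint_distribution (omega : tracial_weight) (r s : nat)
    (u : r.-tuple A) (v : s.-tuple A) (u' : r.-tuple A) (v' : s.-tuple A)
    : Prop :=
  [/\ jointly_in_domain omega u v, jointly_in_domain omega u' v' &
      forall (n : nat) (p : 'I_n -> star_poly r) (q0 : star_poly s)
          (q : 'I_n -> star_poly s), (0 < n)%N ->
        (forall i, no_constant_term (p i)) ->
        omega (star_poly_eval v q0 *
               \prod_(i < n) (star_poly_eval u (p i) * star_poly_eval v (q i)))
        = omega (star_poly_eval v' q0 *
               \prod_(i < n) (star_poly_eval u' (p i) * star_poly_eval v' (q i)))].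

End NonCommutativeProbability.

Section TraceClass.
Context (R : realType).
Local Notation C := (R[i])%type.
Context (H : completeNormedModType C) (ip : {dot H for Num.conj}).

Definition separable_hilbert : Prop :=
  (forall x, ip x x = `|x| ^+ 2) /\ exists2 X : set H, countable X & dense X.

Definition orthonormal_basis (I : choiceType) (e : I -> H) : Prop :=
  (forall i j, ip (e i) (e j) = (i == j)%:R) /\ dense (linear_span (range e)).

Definition is_adjoint (T S : H -> H) : Prop :=
  forall x y, ip (T x) y = ip x (S y).

Definition is_absolute_value (T P : {linear H -> H}) : Prop :=
  [/\ continuous P, forall x, 0 <= ip (P x) x &
      exists2 S : H -> H, is_adjoint T S & P \o P = S \o T].

Definition diag_coef (I : choiceType) (e : I -> H) (T : H -> H) : I -> C^o :=
  fun i => ip (T (e i)) (e i).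

(* Sums are unordered: the limit is taken along the finite subsets of [I]. *)
Definition trace_class (I : choiceType) (e : I -> H) (T : {linear H -> H})
    : Prop :=
  continuous T /\
  exists2 P : {linear H -> H}, is_absolute_value T P &
    cvg (summability.partial_sum (diag_coef e P) @ summability.totally).

Definition op_trace (I : choiceType) (e : I -> H) (T : H -> H) : C :=
  summability.sum (diag_coef e T).

Definition operator_word (r : nat) (x xs : 'I_r -> H -> H)
    (w : seq ('I_r * bool)) : H -> H :=
  foldr (fun l f => (if l.2 then xs l.1 else x l.1) \o f) idfun w.

End TraceClass.

(* Being trace class, and the trace, do not depend on the orthonormal basis [e].
   [xs i] is the adjoint of [x i]. *)
Definition trace_class_family (R : realType) (A : starAlgType R[i])
    (omega : tracial_weight A) (r : nat) (a : r.-tuple A) : Prop :=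
  [set` a] `<=` weight_dom omega /\
  exists (H : completeNormedModType R[i]) (ip : {dot H for Num.conj})
      (I : choiceType) (e : I -> H) (x : 'I_r -> {linear H -> H})
      (xs : 'I_r -> H -> H),
    [/\ separable_hilbert ip, orthonormal_basis ip e,
        forall i, trace_class ip e (x i),
        forall i, is_adjoint ip (x i) (xs i) &
        forall w : seq ('I_r * bool), w != [::] ->
          omega (star_word a w) =
            op_trace ip e (operator_word (fun i => x i : H -> H) xs w)].

(* Main.v *)
Require Import Defs.
From mathcomp Require Import all_boot all_order all_algebra.
From mathcomp Require Import complex.
From mathcomp Require Import all_classical all_reals all_analysis.
From mathcomp Require Import (canonicals) monalg.

Set Implicit Arguments.
Unset Strict Implicit.
Unset Printing Implicit Defensive.

Import GRing.Theory.

Local Open Scope classical_set_scope.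
Local Open Scope ring_scope.

(** Let [S] be the star-algebra generated by [a], [c] and the [a_ i], let [B] be
    the unital one generated by [b] and the [b_ i], and let [J] be the span of
    the monomials [b0 * s1 * b1 * ... * sm * bm] with [m >= 0], a unital
    star-algebra containing [S] and [B].  Call [x] and [x'] congruent when
    [omega (y * x * z) = omega (y * x' * z)] for all contexts [y], [z] in [J],
    all these products lying in the domain of [omega].

    Quantifying over contexts turns the equality of values into a congruence:
    it is linear, compatible with products (replace one factor at a time, the
    other one joining the context) and with adjoints (the adjoint of
    [y * x * z] is again of this form).  So it is enough to compare generators.
    The [a_ i] are congruent to themselves.  For the remaining one,
    traciality gives
      [omega ((y * a * b) * (c * z)) = omega (c * (z * y) * a * b)],
    and cyclic monotonicity extracts [tau b] from the right-hand side, which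
    leaves [tau b * omega ((y * a) * (c * z))]; hence [a * b * c] and
    [tau b *: (a * c)] are congruent ([weight_congruent_middle]).

    Both assertions follow.  The two sides of the equality of joint
    distributions are the values of [omega] at congruent elements.  Moreover
    every element of the algebra generated by [a * b * c] and the [a_ i] is
    congruent to one of [S], and the identity defining cyclic monotonicity only
    involves values that a congruence preserves
    ([cyclically_monotone_congruent]). *)

(** * Linear spans and generated star-subalgebras *)

Section LinearSpanTheory.
Context (K : nzRingType) (V : lmodType K).
Implicit Types (S X : set V) (x : V).

Lemma subspace_scale S k x : linear_subspace S -> S x -> S (k *: x).
Proof. by move=> [S0 SD] Sx; rewrite -[_ *: _]addr0; apply: SD. Qed.

Lemma linear_span_subspace X : linear_subspace (linear_span X).
Proof.
split=> [S [[S0 _] _]|k x y xX yX S SX] //.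
by case: (SX) => -[_ SD] _; apply: SD; [apply: xX | apply: yX].
Qed.

Lemma linear_span_gen X : X `<=` linear_span X.
Proof. exact: sub_gen_smallest. Qed.

Lemma linear_span_sub X S : linear_subspace S -> X `<=` S -> linear_span X `<=` S.
Proof. exact: smallest_sub. Qed.

End LinearSpanTheory.

Section StarAlgebraTheory.
Context (C : numClosedFieldType) (A : starAlgType C).
Implicit Types (S X : set A) (x y : A).

Lemma star_subalgebra_linear S : star_subalgebra S -> linear_subspace S.
Proof. by case. Qed.

Lemma star_subalgebraM S x y : star_subalgebra S -> S x -> S y -> S (x * y).
Proof. by case=> _ SM _; apply: SM. Qed.

Lemma star_subalgebra_star S x : star_subalgebra S -> S x -> S (star x).
Proof. by case=> _ _; apply. Qed.

Lemma star0 : star (0 : A) = 0.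
Proof. by rewrite -[X in star X](scale0r 0) starZ rmorph0 scale0r. Qed.

Lemma star_alg_subalgebra X : star_subalgebra (star_alg X).
Proof.
split; first split=> [S [[[S0 _] _ _] _]|k x y xX yX S SX] //.
- by case: (SX) => -[[_ SD] _ _] _; apply: SD; [apply: xX | apply: yX].
- move=> x y xX yX S SX.
  by apply: star_subalgebraM; [case: SX | apply: xX | apply: yX].
- by move=> x xX S SX; apply: star_subalgebra_star; [case: SX | apply: xX].
Qed.

Lemma star_alg_gen X : X `<=` star_alg X.
Proof. exact: sub_gen_smallest. Qed.

Lemma star_alg_sub X S : star_subalgebra S -> X `<=` S -> star_alg X `<=` S.
Proof. exact: smallest_sub. Qed.

Lemma linear_span_star_subalgebra X :
  (forall x y, X x -> X y -> X (x * y)) -> (forall x, X x -> X (star x)) ->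
  star_subalgebra (linear_span X).
Proof.
move=> XM Xstar; have sX := linear_span_subspace X.
have [X0 XD] := sX.
split=> //.
- move=> x y + yX; apply: (@linear_span_sub _ _ X
    [set x | linear_span X (x * y)]); first split=> [|k x1 x2 /= X1 X2] /=.
  + by rewrite mul0r.
  + by rewrite mulrDl -scalerAl; apply: XD.
  move=> {}x Xx /=; move: y yX; apply: (@linear_span_sub _ _ X
    [set y | linear_span X (x * y)]); first split=> [|k y1 y2 /= Y1 Y2] /=.
  + by rewrite mulr0.
  + by rewrite mulrDr -scalerAr; apply: XD.
  by move=> y Xy /=; apply: linear_span_gen; apply: XM.
- apply: (@linear_span_sub _ _ X [set x | linear_span X (star x)]);
    first split=> [|k x y /= xX yX] /=.
  + by rewrite star0.
  + by rewrite starD starZ; apply: XD.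
  by move=> x Xx /=; apply: linear_span_gen; apply: Xstar.
Qed.

(** The relation can be the congruence below, or membership of the first
    argument in a subalgebra.  Only the words that occur in [p] are considered,
    so that the absence of a constant term excludes the empty word. *)
Lemma star_poly_eval_rel (Q : A -> A -> Prop) r (u u' : r.-tuple A)
    (p : star_poly C r) :
  Q 0 0 ->
  (forall k x x' y y', Q x x' -> Q y y' -> Q (k *: x + y) (k *: x' + y')) ->
  (forall w, monalg.mcoeff (monalg.FMonom w) p != 0 ->
     Q (star_word u w) (star_word u' w)) ->
  Q (star_poly_eval u p) (star_poly_eval u' p).
Proof.
move=> Q0 QD Qw; rewrite /star_poly_eval /monalg.mmap !big_seq.
elim/big_rec2: _ => // -[w] x x' + xx'.
rewrite -monalg.mcoeff_neq0 => pw.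
by rewrite !in_algE !mulr_algl; apply: QD => //; apply: Qw.
Qed.

Lemma star_poly_eval_in S r (v : r.-tuple A) (q : star_poly C r) :
  star_subalgebra S -> S 1 -> [set` v] `<=` S -> S (star_poly_eval v q).
Proof.
move=> sS S1 vS; have [sl SM Sstar] := sS.
apply: (@star_poly_eval_rel (fun x _ => S x) r v v) => [||w _].
- by case: sl.
- by move=> k x _ y _ Sx Sy; case: sl => _; apply.
apply: big_ind => // -[i e] _.
by rewrite /star_letter /=; case: e; [apply: Sstar|]; apply/vS/mem_tnth.
Qed.

End StarAlgebraTheory.

(** * Monomials alternating between two subalgebras *)

Section Monomials.
Context (C : numClosedFieldType) (A : starAlgType C) (S B : set A).

(** The length zero is allowed, so that these elements include the unit and
    are closed under products. *)
Inductive monomial : A -> Prop :=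
| monomial_base b : B b -> monomial b
| monomial_cons b s w : B b -> S s -> monomial w -> monomial (b * s * w).

Definition monomial_span : set A := linear_span monomial.

Hypotheses (sS : star_subalgebra S) (sB : star_subalgebra B) (B1 : B 1).

Lemma monomialM x y : monomial x -> monomial y -> monomial (x * y).
Proof.
elim=> {x} [b Bb|b s w Bb Ss _ IH] My; last first.
  by rewrite -mulrA; apply: monomial_cons => //; apply: IH.
case: My => {y} [b' Bb'|b' s w Bb' Ss Mw].
  by apply: monomial_base; apply: star_subalgebraM.
by rewrite !mulrA; apply: monomial_cons => //; apply: star_subalgebraM.
Qed.

Lemma monomialS s : S s -> monomial s.
Proof.
move=> Ss; rewrite -[s]mul1r -[1 * s]mulr1.
by apply: monomial_cons => //; apply: monomial_base.
Qed.

Lemma monomial_star x : monomial x -> monomial (star x).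
Proof.
elim=> {x} [b Bb|b s w Bb Ss _ IH].
  by apply: monomial_base; apply: star_subalgebra_star.
rewrite !starM; apply: monomialM => //; apply: monomialM.
  by apply: monomialS; apply: star_subalgebra_star.
by apply: monomial_base; apply: star_subalgebra_star.
Qed.

Lemma monomial_span_subalgebra : star_subalgebra monomial_span.
Proof.
by apply: linear_span_star_subalgebra; [exact: monomialM|exact: monomial_star].
Qed.

Lemma monomial_span_base : B `<=` monomial_span.
Proof. by move=> b Bb; apply: linear_span_gen; apply: monomial_base. Qed.

Lemma monomial_span_inner : S `<=` monomial_span.
Proof. by move=> s Ss; apply: linear_span_gen; apply: monomialS. Qed.

Lemma monomial_seq x : monomial x -> exists b0 (L : seq (A * A)),
  [/\ B b0, forall p, p \in L -> S p.1 /\ B p.2 &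
      x = b0 * \prod_(p <- L) (p.1 * p.2)].
Proof.
elim=> {x} [b Bb|b s w Bb Ss _ [b0 [L [Bb0 LSB ->]]]].
  by exists b, [::]; rewrite big_nil mulr1.
exists b, ((s, b0) :: L); split=> //; last by rewrite big_cons /= !mulrA.
by move=> p; rewrite inE => /orP[/eqP->|/LSB].
Qed.

Lemma alternating_products_seq b0 (L : seq (A * A)) :
  L != [::] -> B b0 -> (forall p, p \in L -> S p.1 /\ B p.2) ->
  alternating_products S B (b0 * \prod_(p <- L) (p.1 * p.2)).
Proof.
move=> L0 Bb0 LSB; have LSBi i := LSB _ (mem_tnth i (in_tuple L)).
exists (size L), b0, (fun i => (tnth (in_tuple L) i).1),
  (fun i => (tnth (in_tuple L) i).2).
by split; rewrite ?lt0n ?size_eq0 -?(big_tnth _ _ L xpredT (fun p => p.1 * p.2)) //;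
  move=> i; case: (LSBi i).
Qed.

(** One factor from [S] suffices to make a product of monomials alternating:
    this is what keeps all the products below inside the ideal generated by
    [S], hence inside the domain of the weight. *)
Lemma alternating_sandwich y s z :
  monomial y -> S s -> monomial z -> alternating_products S B (y * s * z).
Proof.
move=> /monomial_seq[b0 [L [Bb0 LSB ->]]] Ss /monomial_seq[b1 [L' [Bb1 LSB' ->]]].
rewrite (_ : _ * _ = b0 * \prod_(p <- L ++ (s, b1) :: L') (p.1 * p.2)).
  apply: alternating_products_seq => //; first by case: (L).
  by move=> p; rewrite mem_cat inE => /orP[/LSB|/orP[/eqP->|/LSB']].
by rewrite big_cat big_cons /= !mulrA.
Qed.

Lemma linear_span_sandwich (D : set A) : linear_subspace D ->
  ideal_span B S `<=` D ->
  forall y s z, monomial_span y -> S s -> monomial_span z -> D (y * s * z).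
Proof.
move=> sD ID y s z + Ss; have [D0 DD] := sD.
move: y; apply: linear_span_sub; first split=> [|k y1 y2 /= Y1 Y2] //.
- by rewrite !mul0r.
- by move=> zJ; rewrite !mulrDl -!scalerAl; apply: DD; [apply: Y1|apply: Y2].
move=> y My; move: z; apply: linear_span_sub; first split=> [|k z1 z2 /= Z1 Z2].
- by rewrite /= mulr0.
- by rewrite /= mulrDr -!scalerAr; apply: DD.
by move=> z Mz; apply: ID; apply: linear_span_gen; apply: alternating_sandwich.
Qed.

End Monomials.

(** * Congruence with respect to a weight *)

Section WeightCongruence.
Context (C : numClosedFieldType) (A : starAlgType C) (omega : tracial_weight A).
Context (J : set A).
Local Notation D := (weight_dom omega).

(** Membership in the domain is part of the relation because [J] contains the
    unit and the values of a weight outside its domain are meaningless; for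
    [x] in [J], [weight_congruent x x] says that [J * x * J] lies in the
    domain. *)
Definition weight_congruent (x x' : A) : Prop :=
  [/\ J x, J x' & forall y z, J y -> J z ->
      [/\ D (y * x * z), D (y * x' * z) &
          omega (y * x * z) = omega (y * x' * z)]].

Hypotheses (sJ : star_subalgebra J) (J1 : J 1).

Let sD : star_subalgebra D := @weight_dom_subalgebra _ _ omega.

Lemma weight0 : omega 0 = 0.
Proof.
have D0 : D 0 by case: sD => -[].
have := @weight_linear _ _ omega 1 0 0 D0 D0.
by rewrite scaler0 addr0 mul1r -[LHS]addr0 => /addrI.
Qed.

Lemma weightZ k x : D x -> omega (k *: x) = k * omega x.
Proof.
have D0 : D 0 by case: sD => -[].
by move=> Dx; rewrite -[_ *: _]addr0 weight_linear // weight0 addr0.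
Qed.

Lemma weight_congruent0 : weight_congruent 0 0.
Proof. by case: sD sJ => -[D0 _] _ _ [[J0 _] _ _]; split=> // y z _ _; rewrite mulr0 mul0r. Qed.

Lemma weight_congruent_lin k x x' y y' :
  weight_congruent x x' -> weight_congruent y y' ->
  weight_congruent (k *: x + y) (k *: x' + y').
Proof.
case: sD sJ => -[_ DD] _ _ [[_ JD] _ _] [Jx Jx' xx'] [Jy Jy' yy'].
split; [exact: JD|exact: JD|] => w z Jw Jz.
have [? ? ex] := xx' w z Jw Jz; have [? ? ey] := yy' w z Jw Jz.
rewrite !mulrDr !mulrDl -!scalerAr -!scalerAl.
by split; [apply: DD|apply: DD|rewrite !weight_linear // ex ey].
Qed.

(** The factors are replaced one at a time: while the first one changes, the
    second one is part of the context. *)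
Lemma weight_congruentM x x' y y' :
  weight_congruent x x' -> weight_congruent y y' ->
  weight_congruent (x * y) (x' * y').
Proof.
move=> [Jx Jx' xx'] [Jy Jy' yy'].
have JM a b : J a -> J b -> J (a * b) by apply: star_subalgebraM.
split; [exact: JM|exact: JM|] => w z Jw Jz.
have [Dx Dx' ex] := xx' w (y * z) Jw (JM _ _ Jy Jz).
have [Dy Dy' ey] := yy' (w * x') z (JM _ _ Jw Jx') Jz.
move: Dx Dx' ex Dy Dy' ey; rewrite !mulrA => Dx Dx' ex Dy Dy' ey.
by split=> //; rewrite ex.
Qed.

(** Taking adjoints exchanges the two contexts.  Thus the adjoint of
    [a * b * c] is handled together with [a * b * c] itself, and the value of
    [tau] at [star b] never enters. *)
Lemma weight_congruent_star x x' :
  weight_congruent x x' -> weight_congruent (star x) (star x').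
Proof.
have Js a : J a -> J (star a) by apply: star_subalgebra_star.
have Ds a : D a -> D (star a) by apply: star_subalgebra_star.
move=> [Jx Jx' xx']; split; [exact: Js|exact: Js|] => y z Jy Jz.
have [Dx Dx' ex] := xx' _ _ (Js _ Jz) (Js _ Jy).
have E a : y * star a * z = star (star z * a * star y).
  by rewrite !starM !starK mulrA.
by rewrite !E; split; [exact: Ds|exact: Ds|rewrite !weight_star // ex].
Qed.

Lemma weight_congruent_mull b x x' :
  J b -> weight_congruent x x' -> weight_congruent (b * x) (b * x').
Proof.
move=> Jb [Jx Jx' xx']; have [_ JM _] := sJ.
split; [exact: JM|exact: JM|] => y z Jy Jz.
by rewrite !(mulrA y); apply: xx' => //; apply: JM.
Qed.

Lemma weight_congruent_mulr b x x' :
  J b -> weight_congruent x x' -> weight_congruent (x * b) (x' * b).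
Proof.
move=> Jb [Jx Jx' xx']; have [_ JM _] := sJ.
split; [exact: JM|exact: JM|] => y z Jy Jz.
have := xx' y (b * z) Jy (JM _ _ Jb Jz).
by rewrite !mulrA.
Qed.

(** The empty product is excluded because [1] need not be congruent to
    itself: [J] is in general not contained in the domain of the weight. *)
Lemma weight_congruent_prod (I : Type) (r : seq I) (F F' : I -> A) :
  (0 < size r)%N -> (forall i, weight_congruent (F i) (F' i)) ->
  weight_congruent (\prod_(i <- r) F i) (\prod_(i <- r) F' i).
Proof.
move=> + FF'; elim: r => // i [_ _|j r /(_ isT) IH _].
  by rewrite !big_seq1.
by rewrite big_cons [X in _ X]big_cons; apply: weight_congruentM.
Qed.

Lemma weight_congruent_ord n (F F' : 'I_n -> A) :
  (0 < n)%N -> (forall i, weight_congruent (F i) (F' i)) ->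
  weight_congruent (\prod_(i < n) F i) (\prod_(i < n) F' i).
Proof.
move=> n0; apply: weight_congruent_prod.
by rewrite /index_enum -enumT size_enum_ord.
Qed.

Lemma weight_congruent_eq x x' :
  weight_congruent x x' -> [/\ D x, D x' & omega x = omega x'].
Proof. by move=> [_ _ /(_ 1 1 J1 J1)]; rewrite !mul1r !mulr1. Qed.

Lemma weight_congruent_poly r (u u' : r.-tuple A) (p : star_poly C r) :
  (forall i, weight_congruent (tnth u i) (tnth u' i)) ->
  no_constant_term p ->
  weight_congruent (star_poly_eval u p) (star_poly_eval u' p).
Proof.
move=> uu' p0; apply: star_poly_eval_rel => [||w pw].
- exact: weight_congruent0.
- by move=> *; apply: weight_congruent_lin.
apply: weight_congruent_prod => [|[i e]].
  by case: w pw => //; rewrite p0 eqxx.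
by rewrite /star_letter /=; case: e => //=; apply: weight_congruent_star.
Qed.

(** The elements that are congruent to some element of [T] form a
    star-subalgebra, by compatibility with the operations. *)
Lemma weight_congruent_star_alg (T X : set A) :
  star_subalgebra T -> (forall x, X x -> exists2 x', T x' & weight_congruent x x') ->
  forall x, star_alg X x -> exists2 x', T x' & weight_congruent x x'.
Proof.
move=> sT XT; apply: star_alg_sub => //; have [[T0 TD] TM Tstar] := sT.
split; first split=> [|k x y [x' Tx xx'] [y' Ty yy']].
- by exists 0 => //; exact: weight_congruent0.
- exists (k *: x' + y'); [exact: TD|exact: weight_congruent_lin].
- move=> x y [x' Tx xx'] [y' Ty yy'].
  by exists (x' * y'); [exact: TM|exact: weight_congruentM].
- move=> x [x' Tx xx'].
  by exists (star x'); [exact: Tstar|exact: weight_congruent_star].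
Qed.

End WeightCongruence.

(** * Consequences of cyclic monotonicity *)

Section CyclicMonotonicity.
Context (C : numClosedFieldType) (A : starAlgType C) (omega : tracial_weight A).
Context (tau : {scalar A}) (S B : set A).
Hypothesis tau1 : tau 1 = 1.
Hypothesis cmSB : cyclically_monotone_alg omega tau S B.
Local Notation D := (weight_dom omega).
Local Notation J := (monomial_span S B).

Let sS : star_subalgebra S. Proof. by case: cmSB. Qed.
Let sB : star_subalgebra B. Proof. by case: cmSB => _ []. Qed.
Let B1 : B 1. Proof. by case: cmSB => _ []. Qed.
Let sD : star_subalgebra D := @weight_dom_subalgebra _ _ omega.
Let sJ : star_subalgebra J := monomial_span_subalgebra sS sB B1.
Let JB : B `<=` J := @monomial_span_base _ _ S B.
Let JS : S `<=` J := monomial_span_inner B1.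
Let J1 : J 1 := JB B1.

Lemma dom_sandwich y s z : J y -> S s -> J z -> D (y * s * z).
Proof.
apply: linear_span_sandwich; first exact: star_subalgebra_linear.
by case: cmSB.
Qed.

Lemma cyclically_monotone_seq (L : seq (A * A)) : L != [::] ->
  (forall p, p \in L -> S p.1 /\ B p.2) ->
  omega (\prod_(p <- L) (p.1 * p.2)) =
    omega (\prod_(p <- L) p.1) * \prod_(p <- L) tau p.2.
Proof.
move=> L0 LSB; have LSBi i := LSB _ (mem_tnth i (in_tuple L)).
case: cmSB => _ _ _ cm; rewrite !(big_tnth _ _ L); apply: cm.
- by rewrite lt0n size_eq0.
- by move=> i; case: (LSBi i).
- by move=> i; case: (LSBi i).
Qed.

(** For a monomial [w] this is cyclic monotonicity applied twice, to the last
    factors [b] and [1]; both sides are linear in [w]. *)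
Lemma weight_pull_last s s' b w : S s -> S s' -> B b -> J w ->
  omega (s * w * s' * b) = tau b * omega (s * w * s').
Proof.
move=> Ss Ss' Bb.
have [[_ DD] _ _] := sD; have [[J0 JD] JM _] := sJ.
have Dl x z : J x -> J z -> D (s * x * s' * z).
  by move=> Jx Jz; apply: dom_sandwich => //; apply: JM => //; apply: JS.
suff: J `<=` [set w | J w /\
    omega (s * w * s' * b) = tau b * omega (s * w * s' * 1)].
  by move=> sub Jw; case: (sub w Jw) => _; rewrite mulr1.
apply: linear_span_sub; first split.
- by split=> //; rewrite !mulr0 !mul0r !weight0 mulr0.
- move=> k x y [Jx ex] [Jy ey]; split; first exact: JD.
  have E z : s * (k *: x + y) * s' * z = k *: (s * x * s' * z) + s * y * s' * z.
    by rewrite mulrDr !mulrDl -scalerAr -!scalerAl.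
  have Jb := JB Bb.
  by rewrite !E !weight_linear ?ex ?ey; try exact: Dl; rewrite mulrDr mulrCA.
move=> {}w Mw; split; first exact: linear_span_gen.
have [b0 [L [Bb0 LSB ->]]] := monomial_seq Mw.
have E b' : B b' -> omega (s * (b0 * \prod_(p <- L) (p.1 * p.2)) * s' * b') =
    omega (s * \prod_(p <- L) p.1 * s') *
      (tau b0 * (\prod_(p <- L) tau p.2) * tau b').
  move=> Bb'; have := @cyclically_monotone_seq ((s, b0) :: rcons L (s', b')).
  rewrite !big_cons !big_rcons /= !mulrA; apply=> // p.
  by rewrite inE mem_rcons inE => /or3P[/eqP->|/eqP->|/LSB].
by rewrite !E // tau1 mulr1 mulrA mulrC.
Qed.

Lemma weight_congruent_refl s : S s -> weight_congruent omega J s s.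
Proof.
by move=> Ss; split=> [||y z Jy Jz]; try exact: JS; split=> //; exact: dom_sandwich.
Qed.

(** The weight is tracial on its domain only, so the context [y] cannot be
    moved around on its own. The point of having the two factors [a] and [c]
    is that both [y a b] and [c z] lie in the domain: exchanging them brings
    [b] to the end, where [tau] evaluates it. *)
Lemma weight_congruent_middle a b c : S a -> B b -> S c ->
  weight_congruent omega J (a * b * c) (tau b *: (a * c)).
Proof.
move=> Sa Bb Sc; have JM x y : J x -> J y -> J (x * y) by apply: star_subalgebraM.
have lJ := star_subalgebra_linear sJ.
have [Ja Jb Jc] := And3 (JS Sa) (JB Bb) (JS Sc).
have key y z b' : J y -> J z -> B b' ->
    D (y * (a * b' * c) * z) /\
    omega (y * (a * b' * c) * z) = tau b' * omega (c * (z * y) * a).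
  move=> Jy Jz Bb'; have Jb' := JB Bb'.
  have E : y * (a * b' * c) * z = (y * a * b') * (c * z) by rewrite !mulrA.
  have Dl : D (y * a * b') by exact: dom_sandwich.
  have Dr : D (c * z) by rewrite -[c]mul1r; exact: dom_sandwich.
  rewrite E; split; first exact: star_subalgebraM.
  rewrite weight_tracial // !mulrA -(mulrA c z y).
  by apply: weight_pull_last => //; apply: JM.
split; first by apply: (JM) => //; apply: JM.
  by apply: (subspace_scale _ lJ); apply: JM.
move=> y z Jy Jz.
have [Db eb] := key y z b Jy Jz Bb; have [D1 e1] := key y z 1 Jy Jz B1.
rewrite mulr1 in D1 e1; rewrite -scalerAr -scalerAl.
split=> //; first by apply: (subspace_scale _ (star_subalgebra_linear sD)).
by rewrite eb weightZ // e1 tau1 mul1r.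
Qed.

(** Cyclic monotonicity is a statement about the values of the weight on
    products, so it passes from [S] to any algebra whose generators are
    congruent to elements of [S]. *)
Lemma cyclically_monotone_congruent (X : set A) :
  (forall x, X x -> exists2 x', S x' & weight_congruent omega J x x') ->
  cyclically_monotone_alg omega tau (star_alg X) B /\
  alternating_products (star_alg X) B `<=` D.
Proof.
move=> XS; have {}XS := weight_congruent_star_alg sJ sS XS.
have choose_ m (s : 'I_m -> A) : (forall i, star_alg X (s i)) ->
    exists s' : 'I_m -> A, forall i, S (s' i) /\ weight_congruent omega J (s i) (s' i).
  move=> sX; suff /choice[s' ss'] : forall i, exists x',
      S x' /\ weight_congruent omega J (s i) x' by exists s'.
  by move=> i; have [x' ? ?] := XS _ (sX i); exists x'.
have altD : alternating_products (star_alg X) B `<=` D.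
  move=> _ [m [b0 [s [b [m0 Bb0 sX bB ->]]]]].
  have [s' ss'] := choose_ _ _ sX.
  have [//|+ _ _] := @weight_congruent_eq _ _ omega J J1
    (b0 * \prod_(i < m) (s i * b i)) (b0 * \prod_(i < m) (s' i * b i)) _; last exact.
  apply: weight_congruent_mull => //; first exact: JB.
  apply: weight_congruent_ord => // i.
  by apply: weight_congruent_mulr; [|apply: JB|case: (ss' i)].
split=> //; split=> //; first exact: star_alg_subalgebra.
  by apply: linear_span_sub => //; exact: star_subalgebra_linear.
move=> m s b m0 sX bB; have [s' ss'] := choose_ _ _ sX.
have [_ _ ->] := weight_congruent_eq J1 (weight_congruent_ord sJ m0
  (fun i => weight_congruent_mulr sJ (JB (bB i)) (proj2 (ss' i)))).
have [_ _ ->] := weight_congruent_eq J1 (weight_congruent_ord sJ m0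
  (fun i => proj2 (ss' i))).
by case: cmSB => _ _ _ -> // i; case: (ss' i).
Qed.

End CyclicMonotonicity.

Theorem theorem17 (R : realType) (A : starAlgType R[i]) (tau : {scalar A})
    (omega : tracial_weight A) (k l : nat) (a c : A) (a_ : k.-tuple A)
    (b : A) (b_ : l.-tuple A) :
  tracial_expectation tau ->
  weight_dom omega a -> weight_dom omega c ->
  (forall i, weight_dom omega (tnth a_ i)) ->
  trace_class_family omega [tuple of a :: a_] ->
  cyclically_monotone omega tau [set` [:: a, c & a_]] [set` b :: b_] ->
  same_joint_distribution omega
    [tuple of a * b * c :: a_] [tuple of b :: b_]
    [tuple of tau b *: (a * c) :: a_] [tuple of b :: b_] /\
  cyclically_monotone omega tau [set` a * b * c :: a_] [set` b :: b_].
Proof.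
move=> [tau1 _] Da Dc Da_ _ [XD cm].
set u := [tuple of a * b * c :: a_]; set u' := [tuple of tau b *: (a * c) :: a_].
set v := [tuple of b :: b_].
set S := star_alg _ in cm; set B := star_alg _ in cm.
have [sS [sB B1] ID _] := cm.
have sJ := monomial_span_subalgebra sS sB B1.
have JB := @monomial_span_base _ _ S B; have J1 := JB _ B1.
have Sa : S a by apply: star_alg_gen; rewrite /= !inE eqxx.
have Sc : S c by apply: star_alg_gen; rewrite /= !inE eqxx orbT.
have Sa_ i : S (tnth a_ i).
  by apply: star_alg_gen; rewrite /= !inE mem_tnth !orbT.
have Bv : [set` v] `<=` B by move=> x vx; apply: star_alg_gen; right.
have Su' i : S (tnth u' i).
  case: (unliftP ord0 i) => [j ->|->]; first by rewrite tnthS.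
  rewrite tnth0; apply: (subspace_scale _ (star_subalgebra_linear sS)).
  exact: (star_subalgebraM sS).
have uu' i : weight_congruent omega (monomial_span S B) (tnth u i) (tnth u' i).
  case: (unliftP ord0 i) => [j ->|->].
    by rewrite !tnthS; exact: (weight_congruent_refl cm).
  rewrite !tnth0; apply: (weight_congruent_middle tau1 cm) => //.
  by apply: Bv; rewrite /= inE eqxx.
have uS x : [set` u] x ->
    exists2 x', S x' & weight_congruent omega (monomial_span S B) x x'.
  by move=> /tnthP[i ->]; exists (tnth u' i).
have [cmu altu] := cyclically_monotone_congruent cm uS.
have uD : [set` u] `<=` weight_dom omega.
  by move=> _ /tnthP[i ->]; have [] := weight_congruent_eq J1 (uu' i).
have u'D : [set` u'] `<=` weight_dom omega.
  by move=> _ /tnthP[i ->]; have [] := weight_congruent_eq J1 (uu' i).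
split; last by [].
split=> //.
  split=> // z [m [b0 [s [d [m0 Bb0 sX dB ->]]]]].
  apply: ID; apply: linear_span_gen; exists m, b0, s, d; split=> // i.
  by apply: star_alg_sub (sX i) => // _ /tnthP[j ->].
move=> n p q0 q n0 p0.
have Bq (f : star_poly _ l.+1) : monomial_span S B (star_poly_eval v f).
  by apply: JB; apply: star_poly_eval_in.
have [_ _ //] := weight_congruent_eq J1 (weight_congruent_mull sJ (Bq q0)
  (weight_congruent_ord sJ n0 (fun i => weight_congruent_mulr sJ (Bq (q i))
    (weight_congruent_poly sJ uu' (p0 i))))).
Qed.
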